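(* Let $d\in\mathbb{Z}$ and let $k$ be a positive integer. The negative polynomial Pell equation $$P^2(X)-(X^{2k}+d)\,Q^2(X)=-1$$ has a non-trivial solution with $P(X),Q(X)\in\mathbb{Z}[X]$ if and only if $d=1$.
   Context: A solution is a pair of polynomials $P(X),Q(X)\in\mathbb{Z}[X]$ satisfying the equation identically; it is non-trivial if $Q(X)\neq 0$. *)

(* Defs.v *)
From mathcomp Require Import all_boot all_order all_algebra.
Set Implicit Arguments.
Unset Strict Implicit.
Unset Printing Implicit Defensive.
Import GRing.Theory.
Local Open Scope ring_scope.

Definition neg_pell_solution (D P Q : {poly int}) : Prop :=
  P ^+ 2 - D * Q ^+ 2 = -1.

(* Main.v *)
Require Import Defs.
From mathcomp Require Import all_boot all_order all_algebra.
From mathcomp Require Import ring zify.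
Import GRing.Theory.
Import Order.TTheory Num.Theory.
Local Open Scope ring_scope.

(** Write [D = X^(2k) + d].  Multiplication by [X^k - sqrt D] sends a solution
    of [P^2 - D Q^2 = c] to one of [P'^2 - D Q'^2 = - d c], and for the right
    sign of [Q] it lowers the degree of [Q].  Descending to [Q = 0] and following
    the leading coefficient [a] of [P + X^k Q], which equals [2 lead(Q)] as long
    as [Q <> 0], gives [a^2 (-d)^n = c 4^n] for some [n].  For [c = -1] this
    forces [n] odd and [a^2 d^n = 4^n] with [a] even and nonzero; hence
    [0 < d < 4], and [d = 2], [d = 3] are excluded by the 2-adic and 3-adic
    valuations. *)

(** The two factors [P + 'X^k * Q] and [P - 'X^k * Q] differ by [2 X^k Q], so the larger has size at
    least [k + size Q]; their product is [c + d Q^2], which leaves at most [size Q - k] for the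
    smaller. *)
Lemma size_pell_diff (R : numDomainType) (d c : R) (k : nat) (P Q : {poly R}) :
    Q != 0 -> P ^+ 2 - ('X^(2 * k) + d%:P) * Q ^+ 2 = c%:P ->
    (size (P - 'X^k * Q)%R <= size (P + 'X^k * Q)%R)%N ->
  (size (P - 'X^k * Q)%R <= size Q - k)%N /\
  (size (P + 'X^k * Q)%R >= k + size Q)%N.
Proof.
move=> Q0 PQ leBA.
move: leBA; set A := P + 'X^k * Q; set B := P - 'X^k * Q => leBA.
have AB : A * B = c%:P + d%:P * Q ^+ 2.
  by rewrite -PQ /A /B mulnC exprM; ring.
have AmB : A - B = 2%:P * ('X^k * Q).
  by rewrite /A /B rmorph_nat; ring.
move: A B AB AmB leBA => A B AB AmB leBA.
have sA : (k + size Q <= size A)%N.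
  have <- : size (A - B) = (k + size Q)%N.
    by rewrite AmB mul_polyC size_scale ?pnatr_eq0 // size_monicM ?monicXn // size_polyXn.
  by rewrite (leq_trans (size_polyD _ _)) // size_polyN geq_max leqnn.
split=> //.
have [->|B0] := eqVneq B 0; first by rewrite size_poly0.
have sQ : (0 < size Q)%N by rewrite size_poly_gt0.
have A0 : A != 0 by rewrite -size_poly_gt0 (leq_trans _ sA) // addn_gt0 sQ orbT.
have := congr1 (fun p : {poly R} => size p) AB; rewrite size_mul // => sAB.
have : (size (c%:P + d%:P * Q ^+ 2)%R <= (size Q + size Q).-1)%N.
  rewrite (leq_trans (size_polyD _ _)) // geq_max.
  rewrite (leq_trans (size_polyC_leq1 _)) /=; last first.
    by move: sQ; case: (size Q) => // q _; rewrite addnS.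
  rewrite mul_polyC (leq_trans (size_scale_leq _ _)) //.
  by rewrite expr2 size_mul.
have sB : (0 < size B)%N by rewrite size_poly_gt0.
by rewrite -sAB; move: sA sQ sB; move: (size A) (size B) (size Q) => a b q; lia.
Qed.

(** As [k > 0], the difference has strictly smaller size than the sum, so subtracting it from the
    sum keeps the leading coefficient. *)
Lemma lead_coef_pell_sum (R : numDomainType) (d c : R) (k : nat) (P Q : {poly R}) :
    (0 < k)%N -> Q != 0 -> P ^+ 2 - ('X^(2 * k) + d%:P) * Q ^+ 2 = c%:P ->
    (size (P - 'X^k * Q)%R <= size (P + 'X^k * Q)%R)%N ->
  lead_coef (P + 'X^k * Q) = 2 * lead_coef Q.
Proof.
move=> k0 Q0 PQ leBA; have [sB sA] := size_pell_diff _ _ _ _ _ _ Q0 PQ leBA.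
have sQ : (0 < size Q)%N by rewrite size_poly_gt0.
rewrite -(lead_coefDl (p := P + 'X^k * Q) (q := - (P - 'X^k * Q))); last first.
  rewrite size_polyN (leq_ltn_trans sB) // (leq_trans _ sA) //.
  by move: sQ; move: (size Q) => q; lia.
have -> : P + 'X^k * Q - (P - 'X^k * Q) = 2%:P * ('X^k * Q).
  by rewrite rmorph_nat; ring.
by rewrite mul_polyC lead_coefZ lead_coef_monicM ?monicXn.
Qed.

Lemma pell_descent (R : numDomainType) (d c : R) (k : nat) (P Q : {poly R}) :
    (0 < k)%N -> d != 0 -> P ^+ 2 - ('X^(2 * k) + d%:P) * Q ^+ 2 = c%:P ->
    (size (P - 'X^k * Q)%R <= size (P + 'X^k * Q)%R)%N ->
  exists n : nat, lead_coef (P + 'X^k * Q) ^+ 2 * (- d) ^+ n = c * 4 ^+ n.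
Proof.
move=> k0 d0; move: {2}(size Q).+1 (ltnSn (size Q)) => m.
elim: m c P Q => // m IH c P Q ltQm PQ leBA.
have [Q0|Q0] := eqVneq Q 0.
  exists 0%N; move: PQ; rewrite Q0 !mulr0 expr0n /= mulr0 subr0 addr0 !mulr1.
  by move=> PQ; rewrite -lead_coef_exp PQ lead_coefC.
have [sB sA] := size_pell_diff _ _ _ _ _ _ Q0 PQ leBA.
have lA := lead_coef_pell_sum _ _ _ _ _ _ k0 Q0 PQ leBA.
have sQ : (0 < size Q)%N by rewrite size_poly_gt0.
(* These are the coefficients of [(P + Q sqrt D) (X^k - sqrt D)]. *)
pose Q' := 'X^k * Q - P; pose P' := 'X^k * P - ('X^(2 * k) + d%:P) * Q.
have A'E : P' + 'X^k * Q' = (- d) *: Q.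
  by rewrite /P' /Q' -mul_polyC polyCN mulnC exprM; ring.
have B'E : P' - 'X^k * Q' = 2%:P * ('X^k * (P - 'X^k * Q)) - d *: Q.
  by rewrite /P' /Q' -mul_polyC rmorph_nat mulnC exprM; ring.
have [||| n En] := IH (- d * c) P' Q'.
- rewrite /Q' -opprB size_polyN (leq_ltn_trans sB) //.
  by move: sQ ltQm; move: (size Q) => q; lia.
- by rewrite polyCM -PQ /P' /Q' polyCN mulnC exprM; ring.
(* The order of sizes persists: the new sum [- d Q] has the size of [Q], as [d] is nonzero, and both
   terms of the new difference have at most that size. *)
- rewrite A'E B'E size_scale ?oppr_eq0 //.
  rewrite (leq_trans (size_polyD _ _)) // size_polyN size_scale ?pnatr_eq0 // geq_max leqnn.
  rewrite andbT mul_polyC size_scale ?pnatr_eq0 //.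
  (* The subtraction in [size Q - k] is truncated; a nonzero [P - 'X^k * Q] forces [k < size Q]. *)
  have [->|B0] := eqVneq (P - 'X^k * Q) 0; first by rewrite mulr0 size_poly0.
  move: (B0); rewrite -size_poly_gt0 => sB0.
  by rewrite size_monicM ?monicXn // size_polyXn; move: sB sB0;
    move: (size (P - _)) (size Q) => b q; lia.
exists n.+1; move: En; rewrite A'E lead_coefZ lA => En.
have nd0 : - d != 0 by rewrite oppr_eq0.
apply: (mulfI nd0); rewrite !exprS.
by transitivity (4 * (- d * c * 4 ^+ n)); [rewrite -En; ring | ring].
Qed.

(** The factor 2 matters: [a ^ 2 * d ^ n = 4 ^ n] would allow [d = 4] with [a = 1]. *)
Lemma sqr_mul_expn_eq (a d n : nat) :
  (0 < a)%N -> odd n -> ((2 * a) ^ 2 * d ^ n = 4 ^ n)%N -> d = 1%N.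
Proof.
move=> a0 on E; have n0 : (0 < n)%N by case: n on {E}.
have d0 : (0 < d)%N.
  case: d E => // E; move: E; rewrite exp0n // muln0 => E.
  by have := expn_gt0 4 n; rewrite -E.
have d4 : (d < 4)%N.
  rewrite ltnNge; apply/negP => d4.
  have : (4 ^ n <= d ^ n)%N by rewrite leq_exp2r.
  have : (0 < 4 ^ n)%N by rewrite expn_gt0.
  nia.
case: d d0 d4 E => [|[|[|[|d]]]] // _ _ E.
  (* For [d = 2] the valuations give [2 + 2 v(a) + n = 2 n], against [n] odd. *)
  have := congr1 (logn 2) E.
  rewrite lognM ?expn_gt0 ?muln_gt0 ?a0 // !lognX.
  have -> : logn 2 4 = 2 by [].
  have -> : logn 2 2 = 1%N by [].
  lia.
have : (3 %| 4 ^ n)%N by rewrite -E dvdn_mull // dvdn_exp.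
by rewrite Euclid_dvdX.
Qed.

Theorem theorem1p3 (d : int) (k : nat) (hk : (0 < k)%N) :
  (exists P Q : {poly int},
      neg_pell_solution ('X^(2 * k) + d%:P) P Q /\ Q <> 0) <-> d = 1.
Proof.
split=> [[P [Q [PQ /eqP Q0]]]|->]; last first.
  exists 'X^k, 1; split; last by apply/eqP; rewrite oner_eq0.
  by rewrite /neg_pell_solution mulnC exprM; ring.
move: PQ; rewrite /neg_pell_solution => PQ.
have d0 : d != 0.
  (* If [d = 0], evaluation at 0 gives [P(0)^2 = -1], since [k > 0]. *)
  apply: contraTneq isT => d0; have := congr1 (horner^~ 0) PQ.
  rewrite d0 !hornerE expr0n muln_eq0 /= eqn0Ngt hk /= => E.
  by have := sqr_ge0 P.[0]; lia.
(* Replacing [Q] by [- Q] swaps the two factors. *)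
wlog leBA : Q PQ Q0 / (size (P - 'X^k * Q)%R <= size (P + 'X^k * Q)%R)%N => [H|].
  have [/H|/ltnW leAB] := leqP (size (P - 'X^k * Q)) (size (P + 'X^k * Q)).
    exact.
  by apply: (H (- Q)); rewrite ?sqrrN ?oppr_eq0 // mulrN opprK.
have {}PQ : P ^+ 2 - ('X^(2 * k) + d%:P) * Q ^+ 2 = (-1)%:P.
  by rewrite PQ polyCN.
have [n] := pell_descent _ _ _ _ _ _ hk d0 PQ leBA.
rewrite (lead_coef_pell_sum _ _ _ _ _ _ hk Q0 PQ leBA) => En.
have l0 : lead_coef Q != 0 by rewrite lead_coef_eq0.
have lt0 : (2 * lead_coef Q) ^+ 2 * (- d) ^+ n < 0.
  by rewrite En mulN1r oppr_lt0 exprn_gt0.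
have sq0 : 0 < (2 * lead_coef Q) ^+ 2 by rewrite exprn_even_gt0 //= mulf_neq0.
have on : odd n.
  move: lt0; apply: contraTT => en.
  by rewrite -leNgt mulr_ge0 ?(ltW sq0) // exprn_even_ge0.
have d_gt0 : 0 < d.
  move: lt0; rewrite pmulr_rlt0 // exprn_odd_lt0 // oppr_lt0 //.
have := congr1 absz En.
rewrite !(abszM, abszX, abszN) mul1n => /(sqr_mul_expn_eq `|lead_coef Q|).
by rewrite absz_gt0 l0 on => /(_ isT isT); lia.
Qed.
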